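(* Let $n,\delta\in\mathbb{N}$ with $\delta\geq 3$ and $n\geq 7$. If $G$ is a connected triangle-free graph of order $n$ and minimum degree $\delta$, then \[\rho(G)-\pi(G)\leq \frac{n+1}{2\delta}+4.\]
   Context: All graphs are finite and simple. For a connected graph $G$ of order $n\ge 2$ and a vertex $v$, the average distance of $v$ is $\overline{\sigma}(v)=\frac{1}{n-1}\sum_{w\in V(G)}d(v,w)$, where $d$ is the shortest-path distance. The proximity is $\pi(G)=\min_{v\in V(G)}\overline{\sigma}(v)$ and the remoteness is $\rho(G)=\max_{v\in V(G)}\overline{\sigma}(v)$. A graph is triangle-free if it contains no $K_3$ as a subgraph. *)

(* Defs.v *)
From mathcomp Require Import all_boot all_order all_algebra.

Set Implicit Arguments.
Unset Strict Implicit.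
Unset Printing Implicit Defensive.

Import Order.TTheory GRing.Theory Num.Theory.

(* A finite simple graph is a symmetric irreflexive relation e on a finite
   type T, which is its vertex set. *)

Definition connected_graph (T : finType) (e : rel T) : Prop :=
  forall x y : T, connect e x y.

Definition triangle_free (T : finType) (e : rel T) : Prop :=
  forall x y z : T, ~ [/\ e x y, e y z & e x z].

Definition degree (T : finType) (e : rel T) (x : T) : nat :=
  #|[set y | e x y]|.

(* Every degree is at most #|T|, so the unit #|T| plays no role when T is
   nonempty (lemma min_degreeP). *)
Definition min_degree (T : finType) (e : rel T) : nat :=
  \big[Order.min/#|T|]_(x : T) degree e x.

Definition has_walk (T : finType) (e : rel T) (x y : T) (k : nat) : bool :=
  [exists p : k.-tuple T, path e x p && (last x p == y)].

(* The least k < #|T| such that there is a walk of k edges from x to y; the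
   value is #|T| if x and y lie in different components. *)
Definition dist (T : finType) (e : rel T) (x y : T) : nat :=
  find (has_walk e x y) (iota 0 #|T|).

Local Open Scope ring_scope.

Definition avg_dist (T : finType) (e : rel T) (v : T) : rat :=
  (\sum_(w : T) dist e v w)%N%:R / (#|T|%:R - 1).

(* Average distances lie between 0 and #|T|, so the units #|T| and 0 below play
   no role when T is nonempty (lemmas proximityP and remotenessP). *)
Definition proximity (T : finType) (e : rel T) : rat :=
  \big[Order.min/#|T|%:R]_(v : T) avg_dist e v.

Definition remoteness (T : finType) (e : rel T) : rat :=
  \big[Order.max/0]_(v : T) avg_dist e v.

Section Sanity.

Variables (T : finType) (e : rel T).

Lemma min_degreeP : (0 < #|T|)%N ->
  (exists x, min_degree e = degree e x) /\
  (forall x, (min_degree e <= degree e x)%N).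
Proof.
move=> /card_gt0P[x0 _]; split=> [|x]; last by rewrite -leEnat bigmin_le_cond.
rewrite /min_degree (bigmin_eq_arg _ x0) // => [|x _]; last exact: max_card.
by eexists.
Qed.

Lemma has_walkP x y k :
  reflect (exists p : seq T, [/\ size p = k, path e x p & last x p = y])
          (has_walk e x y k).
Proof.
apply: (iffP existsP) => [[p /andP[pp /eqP pl]]|[p [ps pp pl]]].
  by exists p; rewrite size_tuple.
by move/eqP: ps => ps; exists (Tuple ps); rewrite /= pp pl eqxx.
Qed.

Lemma dist_leq_card x y : (dist e x y <= #|T|)%N.
Proof. by rewrite -[X in (_ <= X)%N](size_iota 0) find_size. Qed.

Lemma dist_attained x y : connect e x y ->
  exists p : seq T, [/\ size p = dist e x y, path e x p & last x p = y].
Proof.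
case/connectP=> p /shortenP[q qp qu _] ->.
have hq : has (has_walk e x (last x q)) (iota 0 #|T|).
  apply/hasP; exists (size q); last by apply/has_walkP; exists q.
  by rewrite mem_iota add0n -[_.+1]/(size (x :: q)) -(card_uniqP qu) max_card.
have := nth_find 0%N hq; rewrite nth_iota; last first.
  by rewrite -[X in (_ < X)%N](size_iota 0) -has_find.
by rewrite add0n => /has_walkP.
Qed.

Lemma dist_minimal x (p : seq T) :
  path e x p -> (dist e x (last x p) <= size p)%N.
Proof.
move=> pp; rewrite leqNgt; apply/negP=> lt_p.
have := before_find 0%N lt_p.
rewrite nth_iota ?add0n; last exact: leq_trans lt_p (dist_leq_card _ _).
by move/negbT/negP; apply; apply/has_walkP; exists p.
Qed.

Lemma dist_refl x : dist e x x = 0%N.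
Proof. by apply/eqP; rewrite -leqn0; apply: (@dist_minimal x [::]). Qed.

Lemma avg_dist_ge0 v : 0 <= avg_dist e v.
Proof.
have n_gt0 : (0 < #|T|)%N by apply/card_gt0P; exists v.
by rewrite divr_ge0 ?ler0n // subr_ge0 ler1n.
Qed.

Lemma avg_dist_le_card v : avg_dist e v <= #|T|%:R.
Proof.
have n_gt0 : (0 < #|T|)%N by apply/card_gt0P; exists v.
rewrite /avg_dist -(natrB _ n_gt0) subn1.
case: (posnP #|T|.-1) => [->|n1_gt0]; first by rewrite invr0 mulr0 ler0n.
rewrite ler_pdivrMr ?ltr0n // -natrM ler_nat.
rewrite (bigD1 v) //= dist_refl add0n mulnC -(cardC1 v) -sum_nat_const.
by apply: leq_sum => w _; apply: dist_leq_card.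
Qed.

Lemma proximityP : (0 < #|T|)%N ->
  (exists v, proximity e = avg_dist e v) /\
  (forall v, proximity e <= avg_dist e v).
Proof.
move=> /card_gt0P[v0 _]; split=> [|v]; last exact: bigmin_le_cond.
rewrite /proximity (bigmin_eq_arg _ v0) // => [|v _]; last first.
  exact: avg_dist_le_card.
by eexists.
Qed.

Lemma remotenessP : (0 < #|T|)%N ->
  (exists v, remoteness e = avg_dist e v) /\
  (forall v, avg_dist e v <= remoteness e).
Proof.
move=> /card_gt0P[v0 _]; split=> [|v]; last exact: le_bigmax_cond.
rewrite /remoteness (bigmax_eq_arg _ v0) // => [|v _]; last exact: avg_dist_ge0.
by eexists.
Qed.

End Sanity.

(* Main.v *)
Require Import Defs.
From mathcomp Require Import all_boot all_order all_algebra.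
From mathcomp Require Import zify ring lra.

Set Implicit Arguments.
Unset Strict Implicit.
Unset Printing Implicit Defensive.

Import Order.TTheory GRing.Theory Num.Theory.

(** Let x be a vertex of maximum and c one of minimum average distance, and put
    D = d(x, c).  By the triangle inequality, d(x, w) - d(c, w) is at most
    D - 2 max(0, D - d(x, w)), so the difference of the total distances is at
    most n D - 2 W, where W is the sum of max(0, D - d(x, w)) over w.  Two
    adjacent vertices of a triangle-free graph have disjoint neighbourhoods;
    hence, in the distance layers of x, any four consecutive layers whose middle
    two are joined by an edge contain at least 2 delta vertices.  Cutting the
    layers below D into blocks of four, counted from D downwards, bounds W below
    by a quadratic in D, and maximising n D - 2 W over D gives the result. *)

Section Distance.

Variables (T : finType) (e : rel T).
Hypotheses (e_sym : symmetric e) (e_conn : connected_graph e).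

Lemma dist_triangle x y z : dist e x z <= dist e x y + dist e y z.
Proof.
have [p [<- pp lp]] := dist_attained (e_conn x y).
have [q [<- qp lq]] := dist_attained (e_conn y z).
rewrite -size_cat -lq -lp -last_cat dist_minimal //.
by rewrite cat_path pp lp.
Qed.

Lemma dist_sym x y : dist e x y = dist e y x.
Proof.
suff le_dist u v : dist e v u <= dist e u v by apply/eqP; rewrite eqn_leq !le_dist.
have [p [<- pp lp]] := dist_attained (e_conn u v).
have rp : path e v (rev (belast u p)).
  by rewrite -lp rev_path (eq_path (e' := e)) // => a b; rewrite e_sym.
have := dist_minimal rp; rewrite size_rev size_belast.
by case: p pp lp {rp} => [_ <- //|a p _ _]; rewrite /= rev_cons last_rcons.
Qed.

Lemma dist_edge x u v : e u v -> dist e x v <= (dist e x u).+1.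
Proof.
move=> euv; rewrite -addn1; apply: leq_trans (dist_triangle x u v) _.
by rewrite leq_add2l (@dist_minimal _ e u [:: v]) //= euv.
Qed.

(** Prefixes of a shortest walk are shortest, so its consecutive vertices lie in consecutive layers
    of [x]. *)
Lemma edge_between_layers x y k : k < dist e x y ->
  exists u v, [/\ e u v, dist e x u = k & dist e x v = k.+1].
Proof.
have [p [sp pp lp]] := dist_attained (e_conn x y); rewrite -sp => ltk.
have dist_take j : j <= size p -> dist e x (last x (take j p)) = j.
  move=> lej; move: pp lp sp; rewrite -{1 2}(cat_take_drop j p) cat_path last_cat.
  case/andP=> p1 p2 lp sp; have := dist_minimal p1; have := dist_minimal p2.
  have := dist_triangle x (last x (take j p)) y.
  rewrite lp size_drop size_takel //; lia.
exists (last x (take k p)), (last x (take k.+1 p)); split.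
- move: pp; rewrite -{1}(cat_take_drop k.+1 p) cat_path (take_nth x) //.
  by rewrite rcons_path last_rcons => /andP[/andP[]].
- by apply: dist_take; apply: ltnW.
- exact: dist_take.
Qed.

Lemma min_degree_neighbourhoods u v : triangle_free e -> e u v ->
  2 * min_degree e <= #|[set w | e u w] :|: [set w | e v w]|.
Proof.
move=> e_tf euv.
have T_gt0 : 0 < #|T| by apply/card_gt0P; exists u.
have [_ degP] := min_degreeP e T_gt0.
rewrite cardsU (_ : _ :&: _ = set0) ?cards0 ?subn0; last first.
  apply/setP=> w; rewrite !inE; apply/negP=> /andP[euw evw].
  by apply: (e_tf u v w).
by rewrite mul2n -addnn; apply: leq_add (degP u) (degP v).
Qed.

(* The weight D - d(x, w) is at least 4 t + 1 on the t-th block of four layers. *)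
Lemma sum_layer_weights x y q : triangle_free e -> 4 * q <= (dist e x y).+1 ->
  2 * min_degree e * (\sum_(t < q) (4 * t + 1)) <=
  \sum_w (dist e x y - dist e x w).
Proof.
move=> e_tf; set D := dist e x y => leq4D.
pose block t w := 4 * t < D - dist e x w <= 4 * t + 4.
have card_block t : t < q -> 2 * min_degree e <= #|[set w | block t w]|.
  (* Since [4 * q <= D + 1], this subtraction does not truncate. The edge joins the middle two
     layers of block [t], so all neighbours of its ends stay within the block. *)
  move=> ltq; have ltD : D - (4 * t + 3) < D by lia.
  have [u [v [euv du dv]]] := edge_between_layers ltD.
  apply: leq_trans (min_degree_neighbourhoods e_tf euv) _.
  apply/subset_leq_card/subsetP=> w; rewrite !inE /block => /orP[euw|evw].
    have := dist_edge x euw; rewrite e_sym in euw.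
    have := dist_edge x euw; lia.
  have := dist_edge x evw; rewrite e_sym in evw.
  have := dist_edge x evw; lia.
have weight w : \sum_(t < q) block t w * (4 * t + 1) <= D - dist e x w.
  (* The extra factor makes the induction work: the first [q] blocks only reach weight [4 * q], so a
     vertex of the next block has contributed nothing so far. *)
  suff: \sum_(t < q) block t w * (4 * t + 1)
      <= (D - dist e x w) * (D - dist e x w <= 4 * q).
    by move/leq_trans; apply; rewrite -[leqRHS]muln1 leq_mul2l leq_b1 orbT.
  rewrite /block; elim: {leq4D card_block} q => [|q IHq]; first by rewrite big_ord0.
  rewrite big_ord_recr /=; apply: leq_trans (leq_add IHq (leqnn _)) _.
  case: (leqP (_ - _) (4 * q)); case: (leqP (_ - _) (4 * q + 4)); lia.
apply: leq_trans (leq_sum _ (fun w _ => weight w)).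
rewrite exchange_big big_distrr /=; apply: leq_sum => t _.
rewrite -big_distrl leq_mul2r; apply/orP; right.
apply: leq_trans (card_block t (ltn_ord t)) _.
by rewrite -sum1dep_card [leqLHS]big_mkcond; apply: leq_sum => w _; case: (block t w).
Qed.

Lemma total_dist_difference x y :
  \sum_w dist e x w + 2 * (\sum_w (dist e x y - dist e x w)) <=
  \sum_w dist e y w + #|T| * dist e x y.
Proof.
rewrite -sum_nat_const big_distrr -!big_split /=; apply: leq_sum => w _.
(* The first inequality settles [w] with [d(x, w) >= d(x, y)], the second the nearer ones. *)
have := dist_triangle x y w; have := dist_triangle x w y.
rewrite (dist_sym w y); lia.
Qed.

End Distance.

Lemma sum_block_weights q : \sum_(t < q) (4 * t + 1) = 2 * q * q - q.
Proof.
elim: q => [|q IHq]; first by rewrite big_ord0.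
rewrite big_ord_recr /=; move: (\sum_(_ < _) _) IHq => s; nia.
Qed.

(* In the extremal case D = 4 q + 2, with r = n - 4 q delta + delta, the claim
   reads r ^ 2 + 2 delta n >= delta ^ 2 + 8 delta + 1. *)
Lemma block_bound_optimum (n delta D W a b : nat) (q := D.+1 %/ 4) :
    3 <= delta -> 2 * delta <= n ->
    2 * delta * (2 * q * q - q) <= W -> a + 2 * W <= b + n * D ->
  2 * delta * a + 8 * delta + 1 <= 2 * delta * b + n * n + 8 * delta * n.
Proof.
move=> d3 dn leW leab.
have leD : D <= 4 * q + 2 by rewrite /q; lia.
(* Keeps the subtraction exact in the passage to integers. *)
have leq_q : q <= 2 * q * q by nia.
move: q leD leq_q leW => q leD leq_q leW.
have {leD leq_q leW} {}leab : (a%:Z + 4 * delta%:Z * (2 * q%:Z * q%:Z - q%:Z)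
  <= b%:Z + n%:Z * (4 * q%:Z + 2))%R by nia.
suff: (2 * delta%:Z * a%:Z + 8 * delta%:Z + 1
  <= 2 * delta%:Z * b%:Z + n%:Z * n%:Z + 8 * delta%:Z * n%:Z)%R by nia.
have {}d3 : (3 <= delta%:Z :> int)%R by lia.
have {}dn : (2 * delta%:Z <= n%:Z :> int)%R by lia.
move: (Posz n) (Posz delta) (Posz q) (Posz a) (Posz b) d3 dn leab.
move=> {W D n delta q a b} n d q a b d3 dn leab.
have sq := sqr_ge0 (n - 4 * q * d + d)%R.
(* Here [h1] gives 2 d n >= 4 d^2, and [h2] with d >= 3 gives 3 d^2 >= 9 d >= 8 d + 1. *)
have h1 : (0 <= d * (n - 2 * d))%R by apply: mulr_ge0; lia.
have h2 : (0 <= (d - 3) * d)%R by apply: mulr_ge0; lia.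
have h3 : (0 <= d * (b + n * (4 * q + 2) - (a + 4 * d * (2 * q * q - q))))%R.
  by apply: mulr_ge0; lia.
rewrite expr2 in sq; nra.
Qed.

Local Open Scope ring_scope.

Theorem theorem3p1 (n delta : nat) (hdelta : (3 <= delta)%N) (hn : (7 <= n)%N)
    (T : finType) (e : rel T)
    (e_sym : symmetric e) (e_irr : irreflexive e)
    (e_conn : connected_graph e) (e_tf : triangle_free e)
    (card_T : #|T| = n) (mindeg : min_degree e = delta) :
  remoteness e - proximity e <= (n%:R + 1) / (2 * delta%:R) + 4.
Proof.
have T_gt0 : (0 < #|T|)%N by rewrite card_T; lia.
have [[x ->] _] := remotenessP e T_gt0; have [[c ->] _] := proximityP e T_gt0.
(* As [delta] is positive there is an edge, and its ends have disjoint neighbourhoods. *)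
have le2d : (2 * delta <= n)%N.
  have [_ /(_ x)] := min_degreeP e T_gt0; rewrite mindeg => le_deg.
  have /card_gt0P[y] : (0 < degree e x)%N by lia.
  rewrite inE => exy; rewrite -mindeg -card_T.
  exact: leq_trans (min_degree_neighbourhoods e_tf exy) (max_card _).
have leW := sum_layer_weights (q := ((dist e x c).+1 %/ 4)%N) e_sym e_conn e_tf
  (y := c) (x := x) ltac:(lia).
rewrite sum_block_weights mindeg in leW.
have leD := total_dist_difference e_sym e_conn x c; rewrite card_T in leD.
have := block_bound_optimum hdelta le2d leW leD.
rewrite /avg_dist card_T -mulrBl.
move: (\sum_w _)%N (\sum_w _)%N => b a le_ab.
have d_gt0 : 0 < delta%:R :> rat by rewrite ltr0n; lia.
have n_gt1 : 0 < n%:R - 1 :> rat by rewrite subr_gt0 ltr1n; lia.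
rewrite ler_pdivrMr // -subr_ge0.
move: le_ab; rewrite -(ler_nat rat) !(natrM, natrD) => le_ab.
(* Clearing [2 * delta] turns the bound into n^2 - 1 + 8 delta (n - 1), as in
   [block_bound_optimum]. *)
have -> : ((n%:R + 1) / (2 * delta%:R) + 4) * (n%:R - 1) - (a%:R - b%:R) =
  (2 * delta%:R * b%:R + n%:R * n%:R + 8 * delta%:R * n%:R
   - (2 * delta%:R * a%:R + 8 * delta%:R + 1)) / (2 * delta%:R) :> rat.
  by field; rewrite gt_eqF.
by rewrite divr_ge0 ?subr_ge0 // mulr_ge0 // ltW.
Qed.
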